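(* If $D$ is a graded digraph on $n$ vertices with maximum degree $\Delta$, then $$\vec{r}(D) \leq 10^9\, \Delta^3\, 2^{4\Delta}\, n.$$ More precisely, if $D$ has maximum in-degree $\Delta^-$ and maximum out-degree $\Delta^+$, then $$\vec{r}(D) \leq 10^9\, \Delta^+ (\Delta^-)^2\, 2^{4\Delta^-}\, n.$$
   Context: All digraphs are finite. A digraph $D$ is graded with graded partition $V(D)=V_1\cup\dots\cup V_h$ (a partition into disjoint parts) if every edge of $D$ is directed from $V_i$ to $V_{i+1}$ for some $i\in\{1,\dots,h-1\}$; $D$ is graded if such a partition exists for some $h$. Graded digraphs are acyclic. The maximum degree of a digraph is the maximum degree of its underlying undirected graph. A tournament on $N$ vertices is an orientation of the edges of the complete graph $K_N$. For an acyclic digraph $D$, the oriented Ramsey number $\vec{r}(D)$ is the minimum $N$ such that every tournament on $N$ vertices contains a copy of $D$, i.e. $D$ as a (not necessarily induced) subdigraph.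
   Formalization: The formal theorem assumes that D has at least one edge (maximum degree Δ ≥ 1), because for an edgeless digraph on n ≥ 1 vertices the stated bound would read n ≤ 0. *)

(* Defs.v *)
From HB Require Import structures.
From mathcomp Require Import all_boot.

Set Implicit Arguments.
Unset Strict Implicit.
Unset Printing Implicit Defensive.

(* A finite digraph is a finType V of vertices with an edge relation E : rel V,
   where E u v means that u -> v is an edge. *)

Section Digraph.

Variables (V : finType) (E : rel V).

(* The parts are indexed by 'I_h = {0, ..., h-1} instead of {1, ..., h}, and may
   be empty. *)
Definition graded_partition (h : nat) (P : 'I_h -> {set V}) : Prop :=
  [/\ forall i j, i != j -> [disjoint P i & P j],
      \bigcup_i P i = [set: V] &
      forall u v, E u v ->
        exists i j : 'I_h, [/\ val j = (val i).+1, u \in P i & v \in P j]].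

Definition graded : Prop :=
  exists (h : nat) (P : 'I_h -> {set V}), graded_partition P.

Definition max_indegree : nat := \max_(v : V) #|[set u | E u v]|.

Definition max_outdegree : nat := \max_(v : V) #|[set u | E v u]|.

Definition max_degree : nat := \max_(v : V) #|[set u | E u v || E v u]|.

Definition tournament (W : finType) (T : rel W) : Prop :=
  irreflexive T /\ (forall x y : W, x != y -> T x y (+) T y x).

Definition contains_copy (W : finType) (T : rel W) : Prop :=
  exists f : V -> W, injective f /\ (forall u v, E u v -> T (f u) (f v)).

Definition unavoidable (N : nat) : Prop :=
  forall T : rel 'I_N, tournament T -> contains_copy T.

(* is_oriented_ramsey r means r = \vec{r}(D).  It is a relation because the
   minimum exists only for acyclic digraphs. *)
Definition is_oriented_ramsey (r : nat) : Prop :=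
  unavoidable r /\ (forall N, unavoidable N -> r <= N).

End Digraph.

(* Main.v *)
Require Import Defs.
From HB Require Import structures.
From mathcomp Require Import all_boot.
From mathcomp Require Import zify.
From Stdlib Require Import Classical.

(** Take an ordering of the tournament maximizing the number of forward edges: every vertex
    beats at least half of each segment right after it.  So if B lies in a segment of length l,
    the edges from B to a following segment of length q l have density at least 1/2 - 1/(2q),
    and some short subsegment of it contains a dense set B' each of whose vertices has at least
    (1/2 - 1/q) |B| in-neighbours in B.  Iterating, with one set per layer of the digraph, and
    then running dependent random choice from the last layer back to the first, yields disjoint
    sets A_i in which few d-tuples have few common out-neighbours in A_(i+1), where d is the
    maximum in-degree.  The digraph embeds greedily in these sets, layer by layer, keeping the
    already embedded in-neighbours of every vertex extendable to mostly rich d-tuples.  Choosing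
    q of order d makes (1 - 2/q)^(4d) a constant, so that only 2^(4d) is lost. *)

Set Implicit Arguments.
Unset Strict Implicit.
Unset Printing Implicit Defensive.

(** * Sums over tuples and the power mean inequality *)

Section IteratedSum.

Variable W : finType.
Implicit Types (A B P U Y : {set W}) (F G : {set W} -> nat) (k l m n : nat).

(* The sum of F (U :|: {x_1, ..., x_k}) over all k-tuples (x_1, ..., x_k) of elements of A. *)
Fixpoint iter_sum A k F U : nat :=
  if k is k'.+1 then \sum_(x in A) iter_sum A k' F (x |: U) else F U.

Lemma leq_iter_sum A k F G U :
  (forall Y, F Y <= G Y) -> iter_sum A k F U <= iter_sum A k G U.
Proof.
move=> leFG; elim: k U => [|k IHk] U //=.
by apply: leq_sum => x _; apply: IHk.
Qed.

Lemma eq_iter_sum A k F G U : F =1 G -> iter_sum A k F U = iter_sum A k G U.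
Proof.
move=> eqFG; elim: k U => [|k IHk] U //=.
by apply: eq_bigr => x _; apply: IHk.
Qed.

Lemma iter_sumD A k F G U :
  iter_sum A k (fun Y => F Y + G Y) U = iter_sum A k F U + iter_sum A k G U.
Proof.
elim: k U => [|k IHk] U //=; rewrite -big_split.
by apply: eq_bigr => x _; apply: IHk.
Qed.

Lemma iter_sumMl A k m F U :
  iter_sum A k (fun Y => m * F Y) U = m * iter_sum A k F U.
Proof.
elim: k U => [|k IHk] U //=; rewrite big_distrr.
by apply: eq_bigr => x _; apply: IHk.
Qed.

Lemma iter_sum_big (I : finType) (Q : pred I) A k (F : I -> {set W} -> nat) U :
  iter_sum A k (fun Y => \sum_(i | Q i) F i Y) U =
  \sum_(i | Q i) iter_sum A k (F i) U.
Proof.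
elim: k U => [|k IHk] U //=.
rewrite exchange_big; apply: eq_bigr => x _; exact: IHk.
Qed.

Lemma iter_sum_exchange A k B l (F : {set W} -> {set W} -> nat) U Y :
  iter_sum A k (fun U' => iter_sum B l (F U') Y) U =
  iter_sum B l (fun Y' => iter_sum A k (F^~ Y') U) Y.
Proof.
elim: l Y => [|l IHl] Y //=.
rewrite iter_sum_big; apply: eq_bigr => x _; exact: IHl.
Qed.

Lemma iter_sum_restrict A k P F U :
  iter_sum A k (fun Y => (Y \subset P) * F Y) U =
  (U \subset P) * iter_sum (A :&: P) k F U.
Proof.
elim: k U => [|k IHk] U //=.
rewrite big_distrr /= big_mkcond [RHS]big_mkcond /=.
apply: eq_bigr => x _; rewrite IHk subUset sub1set inE.
by case: (x \in A); case: (x \in P); rewrite //= ?mul0n.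
Qed.

Lemma iter_sum1 A k U : iter_sum A k (fun=> 1) U = #|A| ^ k.
Proof.
elim: k U => [|k IHk] U //=; rewrite expnS -sum_nat_const.
by apply: eq_bigr => x _; apply: IHk.
Qed.

Lemma iter_sum_const A k m U : iter_sum A k (fun=> m) U = m * #|A| ^ k.
Proof. by rewrite -(iter_sum1 A k U) -iter_sumMl; apply: eq_iter_sum => Y; rewrite muln1. Qed.

Lemma iter_sum_averaging A k F G U :
  0 < #|A| -> iter_sum A k F U <= iter_sum A k G U ->
  exists Y, F Y <= G Y.
Proof.
move=> A_gt0; elim: k U => [|k IHk] U /=; first by exists U.
move=> le_sum.
case: (boolP [exists x in A,
    iter_sum A k F (x |: U) <= iter_sum A k G (x |: U)]).
  by case/exists_inP=> x _ /IHk.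
move=> /exists_inPn gtFG; case/card_gt0P: A_gt0 => x0 x0A.
have : \sum_(x in A) (iter_sum A k G (x |: U) + 1) <=
       \sum_(x in A) iter_sum A k F (x |: U).
  by apply: leq_sum => x xA; rewrite addn1 ltnNge gtFG.
rewrite big_split /= sum1_card => le2.
have : 0 < #|A| by apply/card_gt0P; exists x0.
lia.
Qed.

(* The convex function x ^ n.+1 lies above its tangent at m; truncated subtraction is
   avoided by moving the negative term to the right. *)
Lemma tangent_line_leq m x n : n.+1 * m ^ n * x <= x ^ n.+1 + n * m ^ n.+1.
Proof.
elim: n => [|n IHn]; first by rewrite !expn1; lia.
move: IHn; rewrite !expnS; set y := m ^ n; set z := x ^ n => IHn.
have := leq_mul (leqnn x) IHn.
have := leq_mul (leqnn (n.+1 * y)) (nat_Cauchy m x).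
rewrite !expnS !expn0; nia.
Qed.

(** Jensen's inequality: the tangent at [m], a lower bound of the mean, is summed over all
    tuples. *)
Lemma iter_sum_power_mean A k n m F U :
  m * #|A| ^ k <= iter_sum A k F U ->
  m ^ n * #|A| ^ k <= iter_sum A k (fun Y => F Y ^ n) U.
Proof.
case: n => [|n] le_mF; first by rewrite expn0 mul1n iter_sum1.
have := @leq_iter_sum A k _ _ U (fun Y => tangent_line_leq m (F Y) n).
rewrite iter_sumMl iter_sumD iter_sum_const.
have := leq_mul (leqnn (n.+1 * m ^ n)) le_mF.
have -> : n.+1 * m ^ n * (m * #|A| ^ k) = n.+1 * (m ^ n.+1 * #|A| ^ k).
  by rewrite expnSr !mulnA.
rewrite -mulnA; lia.
Qed.

End IteratedSum.

(** * Dependent random choice *)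

Section DependentRandomChoice.

Variables (W : finType) (T : rel W).
Implicit Types (A B U X Y : {set W}) (F : {set W} -> nat).

Definition common_out Y U : {set W} := [set y in Y | [forall x in U, T x y]].

Definition common_in B U : {set W} := [set x in B | [forall y in U, T x y]].

(** Both sides count pairs of tuples with all edges from [X] to [Y], weighted by [F X]. *)
Lemma iter_sum_common A B F m n :
  iter_sum A n (fun Y => iter_sum (common_in B Y) m F set0) set0 =
  iter_sum B m (fun X => F X * #|common_out A X| ^ n) set0.
Proof.
pose inc X Y := [forall x in X, [forall y in Y, T x y]].
have inc_in X Y : inc X Y = (X \subset [set x | [forall y in Y, T x y]]).
  apply/forall_inP/subsetP => sub x xX.
    by rewrite inE sub.
  by have := sub x xX; rewrite inE.
have inc_out X Y : inc X Y = (Y \subset [set y | [forall x in X, T x y]]).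
  apply/forall_inP/subsetP => sub.
    by move=> y yY; rewrite inE; apply/forall_inP=> x /sub/forall_inP; apply.
  by move=> x xX; apply/forall_inP=> y /sub; rewrite inE => /forall_inP; apply.
transitivity (iter_sum A n (fun Y => iter_sum B m (fun X => inc X Y * F X) set0) set0).
  apply: eq_iter_sum => Y /=; symmetry; under eq_iter_sum do rewrite inc_in.
  rewrite iter_sum_restrict sub0set mul1n; congr iter_sum.
  by apply/setP=> x; rewrite !inE.
rewrite iter_sum_exchange; apply: eq_iter_sum => X.
under eq_iter_sum do rewrite inc_out.
rewrite iter_sum_restrict sub0set mul1n iter_sum_const; congr (_ * _ ^ _).
by congr #|pred_of_set _|; apply/setP=> x; rewrite !inE.
Qed.

Lemma sum_card_common A B m n :
  iter_sum A n (fun Y => #|common_in B Y| ^ m) set0 =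
  iter_sum B m (fun X => #|common_out A X| ^ n) set0.
Proof.
under eq_iter_sum do rewrite -(iter_sum1 _ _ set0).
by rewrite iter_sum_common; apply: eq_iter_sum => X; rewrite mul1n.
Qed.

(** Sidorenko's bound for complete bipartite graphs: the power mean inequality is used for n-tuples
    of [A], then for single vertices of [B], each time followed by a double count. *)
Lemma complete_bipartite_count A B (a b m n : nat) :
  (forall y, y \in A -> a * #|B| <= b * #|common_in B [set y]|) ->
  (a ^ n * #|B|) ^ m * #|A| ^ n <=
  iter_sum A n (fun Y => (b ^ n * #|common_in B Y|) ^ m) set0.
Proof.
move=> minB; apply: iter_sum_power_mean.
rewrite iter_sumMl; under eq_iter_sum do rewrite -[#|_|]expn1.
rewrite sum_card_common -iter_sumMl.
under eq_iter_sum do rewrite -expnMn.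
rewrite -mulnA [_ * #|A| ^ n]mulnC mulnA -expnMn -[X in _ * X]expn1.
apply: iter_sum_power_mean.
rewrite iter_sumMl; under eq_iter_sum do rewrite -[#|_|]expn1.
rewrite -sum_card_common -iter_sumMl /= expn1.
rewrite mulnAC mulnC.
rewrite -sum_nat_const; apply: leq_sum => y yA.
by rewrite expn1 setU0; apply: minB.
Qed.

Definition poor_set A (e : nat) U : bool := e * #|common_out A U| < #|A|.

(** In the embedding, [U] holds the images of in-neighbours already placed, and [k] bounds the
    number still to come. *)
Definition poor_extensions A A' (e k : nat) U : nat :=
  iter_sum A k (fun Y => poor_set A' e Y : nat) U.

(** [B'] is the common in-neighbourhood of a random t-tuple of [A]: on average the d-th power of its
    size is large and few poor d-tuples survive in it. Both facts enter one inequality, each paid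
    for by one half of the factor 2, so that a single choice achieves both. *)
Lemma dependent_random_choice A B (a b e d t : nat) :
  0 < #|A| ->
  (forall y, y \in A -> a * #|B| <= b * #|common_in B [set y]|) ->
  exists2 B' : {set W}, B' \subset B &
    (a ^ t * #|B|) ^ d + a ^ (t * d) * e ^ t * poor_extensions B' A e d set0
    <= 2 * (b ^ t * #|B'|) ^ d.
Proof.
move=> A_gt0 minB.
have [Y leY] : exists Y,
    (a ^ t * #|B|) ^ d
      + a ^ (t * d) * e ^ t * poor_extensions (common_in B Y) A e d set0
    <= 2 * (b ^ t * #|common_in B Y|) ^ d.
  apply: (@iter_sum_averaging _ A t _ _ set0) => //.
  rewrite iter_sumD iter_sum_const !iter_sumMl mul2n -addnn.
  (* A poor tuple has at most #|A| / e common out-neighbours, so at most (#|A| / e)^t choices of the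
     t-tuple keep it. *)
  have few : e ^ t * iter_sum B d
      (fun X => poor_set A e X * #|common_out A X| ^ t) set0
      <= #|B| ^ d * #|A| ^ t.
    rewrite -iter_sumMl mulnC -(iter_sum_const _ _ _ set0).
    apply: leq_iter_sum => X; rewrite mulnCA -expnMn /poor_set.
    case: ltnP => // /ltnW le_eA; rewrite mul1n.
    by case: (t) => // t'; rewrite leq_exp2r.
  apply: leq_add; first exact: complete_bipartite_count.
  rewrite iter_sum_common -mulnA.
  apply: leq_trans (leq_mul (leqnn _) few) _.
  apply: leq_trans (complete_bipartite_count d t minB).
  by rewrite expnMn -expnM mulnA.
exists (common_in B Y) => //.
by apply/subsetP=> x; rewrite inE => /andP[].
Qed.

End DependentRandomChoice.

(** * Median orders and the passage to the next segment *)

Section MedianOrder.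

Variables (W : finType) (T : rel W).
Implicit Types (s : seq W) (B : {set W}).

Definition median_order s : Prop :=
  forall s1 v s2 s3, s = s1 ++ v :: s2 ++ s3 -> size s2 <= 2 * count (T v) s2.

Fixpoint forward_edges s : nat :=
  if s is x :: s' then count (T x) s' + forward_edges s' else 0.

Lemma forward_edges_cat s1 s2 :
  forward_edges (s1 ++ s2) =
  forward_edges s1 + \sum_(x <- s1) count (T x) s2 + forward_edges s2.
Proof.
elim: s1 => [|x s1 IHs] /=; first by rewrite big_nil.
rewrite IHs count_cat big_cons; lia.
Qed.

Lemma median_order_cat s1 s2 : median_order (s1 ++ s2) -> median_order s2.
Proof.
by move=> med p1 v p2 p3 def_s2; apply: (med (s1 ++ p1) v p2 p3); rewrite def_s2 catA.
Qed.

(* Moving v past the segment s2 that follows it cannot increase the number of forward edges. *)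
Lemma exists_median_order :
  tournament T -> exists2 s, perm_eq s (enum W) & median_order s.
Proof.
case=> _ tourT.
have permT : perm_eq (enum_tuple W) (enum W) by [].
case: (@arg_maxnP _ (enum_tuple W : #|W|.-tuple W)
  (fun t : #|W|.-tuple W => perm_eq t (enum W))
  (fun t : #|W|.-tuple W => forward_edges t) permT) => t permt maxt.
exists (t : seq W) => // s1 v s2 s3 def_t.
have uniqt : uniq t by rewrite (perm_uniq permt) enum_uniq.
have perm' : perm_eq (s1 ++ s2 ++ v :: s3) t.
  by rewrite def_t perm_cat2l -cat1s perm_catCA perm_sym.
have size' : size (s1 ++ s2 ++ v :: s3) == #|W|.
  by rewrite (perm_size perm') size_tuple.
have := maxt (Tuple size'); rewrite /= (perm_trans perm') // => /(_ isT).
have count_v p : count (T^~ v) p = \sum_(x <- p) T x v.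
  by rewrite -sum1_count big_mkcond; apply: eq_bigr => x _; case: (T x v).
have count_tour : count (T^~ v) s2 + count (T v) s2 = size s2.
  have v_s2 : v \notin s2.
    move: uniqt; rewrite def_t cat_uniq /= mem_cat.
    by case/and3P=> _ _ /andP[/norP[]].
  elim: (s2) v_s2 => //= x p IHp; rewrite in_cons negb_or => /andP[vx vp].
  rewrite -(IHp vp); have := tourT _ _ vx.
  by case: (T v x); case: (T x v) => //= _; lia.
have -> : forward_edges t = forward_edges (s1 ++ v :: s2 ++ s3) by rewrite def_t.
rewrite [in X in X <= _]forward_edges_cat [in X in _ <= X]forward_edges_cat.
have -> : \sum_(x <- s1) count (T x) (s2 ++ v :: s3) =
          \sum_(x <- s1) count (T x) (v :: s2 ++ s3).
  apply: eq_bigr => x _; apply/permP.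
  by rewrite -cat1s perm_catCA.
rewrite /= !forward_edges_cat /= count_cat.
rewrite !big_split /= -!count_v; lia.
Qed.

(** Of the [m] consecutive blocks of length [l], one reaches the density 1/c of the whole. *)
Lemma count_pigeonhole (p : pred W) c l m s :
  0 < m -> size s = m * l -> m * l <= c * count p s ->
  exists s1 s2 s3, [/\ s = s1 ++ s2 ++ s3, size s2 = l & l <= c * count p s2].
Proof.
elim: m s => // m IHm s _ size_s; case: (leqP l (c * count p (take l s))) => [ge_l|lt_l] le_s.
  exists [::], (take l s), (drop l s); rewrite cat_take_drop size_takel //; lia.
have : size (drop l s) = m * l by rewrite size_drop; lia.
have cnt : count p s = count p (take l s) + count p (drop l s).
  by rewrite -count_cat cat_take_drop.
have m_gt0 : 0 < m.
  case: m IHm size_s le_s => //= _ size_s; rewrite take_oversize in lt_l; lia.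
move=> size_d; case: (IHm _ m_gt0 size_d); first by lia.
move=> s1 [s2 [s3 [def_d sz2 le2]]].
exists (take l s ++ s1), s2, s3; split=> //.
by rewrite -catA -def_d cat_take_drop.
Qed.

(** Two averagings: density 1/2 - 1/(2q) from [B] forces a fraction 1/(2q) of the next stretch to
    have in-density 1/2 - 1/q, and some block of length [l] keeps that fraction. The bound on [R1]
    keeps the total length linear. *)
Lemma next_layer (q l : nat) X R B :
  uniq (X ++ R) -> median_order (X ++ R) -> {subset B <= X} ->
  0 < l -> 0 < size X -> 0 < #|B| -> 1 < q -> q * size X + l <= size R ->
  exists R1 X' R2 B',
    [/\ R = R1 ++ X' ++ R2, size X' = l, size R1 <= q * size X,
        {subset B' <= X'} &
        l <= 2 * q * #|B'| /\
        forall y, y \in B' ->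
          (q - 2) * #|B| <= 2 * q * #|common_in T B [set y]|].
Proof.
move=> uniqXR med BX l_gt0 X_gt0 B_gt0 q_gt1 le_R.
(* The length of [J] is a multiple of [l], between [q * size X] and [q * size X + l]. *)
pose m := (q * size X + l) %/ l; pose J := take (m * l) R.
have m_gt0 : 0 < m by rewrite divn_gt0 // leq_addl.
have le_ml : m * l <= q * size X + l by apply: leq_divM.
have ge_ml : q * size X <= m * l.
  have := divn_eq (q * size X + l) l; have := ltn_pmod (q * size X + l) l_gt0.
  rewrite -/m; lia.
have sizeJ : size J = m * l by rewrite size_takel //; lia.
(* The segment right after [v] ending with [J] loses at most [size X] to the rest of [X]. *)
have out_J v : v \in B -> m * l <= 2 * count (T v) J + size X.
  move=> vB; move: med; case/splitPr: (BX v vB) => X1 X2 med'.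
  have := med' X1 v (X2 ++ J) (drop (m * l) R).
  rewrite -!catA /= /J cat_take_drop => /(_ erefl).
  rewrite size_cat count_cat sizeJ size_cat /=.
  have := count_size (T v) X2; lia.
pose indeg y := #|common_in T B [set y]|.
have indegE y : indeg y = \sum_(v in B) T v y.
  rewrite /indeg -sum1_card big_mkcond [RHS]big_mkcond; apply: eq_bigr => v _.
  rewrite inE; case: (v \in B) => //=.
  have -> : [forall z in [set y], T v z] = T v y; last by case: (T v y).
  apply/forall_inP/idP => [-> //|Tvy z]; first exact: set11.
  by rewrite inE => /eqP->.
have sum_indeg : \sum_(y <- J) indeg y = \sum_(v in B) count (T v) J.
  under eq_bigr do rewrite indegE.
  rewrite exchange_big; apply: eq_bigr => v _.
  by rewrite -sum1_count [RHS]big_mkcond; apply: eq_bigr => y _; case: (T v y).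
have many : #|B| * (m * l) <= 2 * \sum_(y <- J) indeg y + #|B| * size X.
  rewrite sum_indeg -!sum_nat_const big_distrr -big_split /=.
  by apply: leq_sum => v /out_J.
pose rich y := (q - 2) * #|B| <= 2 * q * indeg y.
have few : 2 * q * \sum_(y <- J) indeg y <=
    (q - 2) * #|B| * (m * l) + 2 * q * #|B| * count rich J.
  have -> : count rich J = \sum_(y <- J) rich y.
    by rewrite -sum1_count big_mkcond; apply: eq_bigr => y _; case: (rich y).
  rewrite -sizeJ -[size J]sum1_size !big_distrr -big_split /=.
  apply: leq_sum => y _; rewrite muln1 /rich.
  case: (leqP (_ * #|B|)) => /= [_|/ltnW le]; last by rewrite muln0 addn0.
  rewrite muln1; have : indeg y <= #|B|.
    by apply: subset_leq_card; apply/subsetP=> x; rewrite inE => /andP[].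
  nia.
have rich_count : m * l <= 2 * q * count rich J.
  rewrite -(leq_pmul2l B_gt0).
  have le_qB : q * #|B| * size X <= #|B| * (m * l) by nia.
  have arith k S P c b x : 1 < k -> k * b * x <= P -> P <= 2 * S + b * x ->
      2 * k * S <= (k - 2) * P + 2 * k * b * c -> P <= b * (2 * k * c).
    by case: k => [|[|k]] // _; rewrite subSS subSS subn0; nia.
  by apply: (arith q _ _ _ _ _ q_gt1 le_qB many); rewrite [in X in _ <= X + _]mulnA.
have [J1 [X' [J2 [def_J sizeX' rich_X']]]] := count_pigeonhole m_gt0 sizeJ rich_count.
have def_R : R = J1 ++ X' ++ (J2 ++ drop (m * l) R).
  by rewrite 2!catA -(catA J1) -def_J cat_take_drop.
exists J1, X', (J2 ++ drop (m * l) R), [set y in X' | rich y]; split=> //.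
- have := congr1 size def_J; rewrite !size_cat sizeJ sizeX' => eq_J.
  by rewrite -(leq_add2r l); apply: leq_trans le_ml; rewrite eq_J addnA leq_addr.
- by move=> y; rewrite inE => /andP[].
split; last by move=> y; rewrite inE => /andP[].
have uniqX' : uniq X'.
  move: uniqXR; rewrite def_R cat_uniq => /and3P[_ _].
  by rewrite cat_uniq => /and3P[_ _]; rewrite cat_uniq => /and3P[].
suff -> : #|[set y in X' | rich y]| = count rich X' by [].
rewrite -size_filter -(card_uniqP (filter_uniq _ uniqX')).
by apply: eq_card => y; rewrite mem_filter inE andbC.
Qed.

End MedianOrder.

(** * Sets with few poor extensions *)

Section SafeSets.

Variables (W : finType) (T : rel W) (A A' : {set W}) (e r : nat).
Implicit Types (U Y : {set W}).

(* Less than a fraction r ^- k of the extensions of U by k elements of A are poor. *)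
Definition safe k U : bool := poor_extensions T A A' e k U * r ^ k < #|A| ^ k.

Lemma poor_setS U Y : U \subset Y -> poor_set T A' e U -> poor_set T A' e Y.
Proof.
move=> /subsetP UY; apply: leq_ltn_trans; rewrite leq_mul2l; apply/orP; right.
apply: subset_leq_card; apply/subsetP=> x; rewrite !inE => /andP[-> /forall_inP xY].
by apply/forall_inP=> y /UY; apply: xY.
Qed.

(* If U itself is poor then all its extensions are. *)
Lemma safe_rich k U : 0 < r -> safe k U -> #|A'| <= e * #|common_out T A' U|.
Proof.
move=> r_gt0; apply: contraLR; rewrite -ltnNge -leqNgt => poorU.
have -> : poor_extensions T A A' e k U = #|A| ^ k.
  rewrite /poor_extensions.
  elim: k U poorU => [|k IHk] U poorU /=; first by rewrite /poor_set poorU.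
  rewrite expnS -sum_nat_const; apply: eq_bigr => x _; apply: IHk.
  by apply: poor_setS poorU; apply: subsetUr.
by rewrite leq_pmulr // expn_gt0 r_gt0.
Qed.

(** Markov's inequality: each [x] with [x |: U] unsafe accounts for at least (#|A| / r)^k poor
    extensions of [U], out of fewer than (#|A| / r)^(k+1). *)
Lemma few_unsafe k U :
  safe k.+1 U -> r * #|[set x in A | ~~ safe k (x |: U)]| <= #|A|.
Proof.
rewrite /safe /poor_extensions /=; set bad := [set x in A | _] => ltA.
have A_gt0 : 0 < #|A| by case: posnP ltA => // ->; rewrite exp0n.
have Ak_gt0 : 0 < #|A| ^ k by rewrite expn_gt0 A_gt0.
have : #|bad| * #|A| ^ k <=
    (\sum_(x in A) iter_sum A k (fun Y => poor_set T A' e Y : nat) (x |: U)) * r ^ k.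
  rewrite -sum_nat_const big_distrl big_mkcond [X in _ <= X]big_mkcond /=.
  apply: leq_sum => x _; rewrite inE -leqNgt.
  by case: (x \in A) => //=; case: ifP.
move=> le_bad; rewrite -(leq_pmul2r Ak_gt0) -mulnA -expnS.
apply: leq_trans (ltnW ltA); by rewrite expnS [X in _ <= X]mulnCA leq_mul2l le_bad orbT.
Qed.

End SafeSets.

(** * Construction of the chain of sets, one per layer *)

Section LayerChain.

Variables (W : finType) (T : rel W) (d D : nat).
Hypotheses (d_gt0 : 0 < d) (D_gt0 : 0 < D).
Implicit Types (A B : {set W}) (X R : seq W).

(** [q] makes (1 - 2/q)^(2d) at least 1/2. The candidates for a vertex form a fraction 1/e of their
    set, and [r] lets the unsafe choices for [D] out-neighbours fill at most half of that. Then e^2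
    = 8 r 2^(2d), as dependent random choice requires. *)
Let q := 16 * d.
Let e := 16 * D * 2 ^ (2 * d).
Let r := 2 * D * e.
(* Each B_i has density 1/(2q) in its segment, the passage from B_i to A_i costs a factor
   4 * 2 ^ (2 * d), and the embedding needs |A_i| >= 2 * e * n_i where n_i is the size of the
   i-th layer: lam * n_i is the resulting segment length. *)
Let lam := 2 ^ 12 * D * d * 2 ^ (4 * d).

(** Bernoulli: (x/m)^n >= 1 - n (1 - x/m) >= 1/2. *)
Lemma leq_expn_double m x n : 2 * n * (m - x) <= m -> m ^ n <= 2 * x ^ n.
Proof.
case: n => [|n] // le_m; have := tangent_line_leq m x n.
case: (leqP m x) => [le_mx _|/ltnW/subnK def_m].
  by apply: leq_trans (leq_pmull _ _); rewrite ?leq_exp2r.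
have := leq_mul (leqnn (m ^ n)) le_m; rewrite !expnSr.
move: def_m; move: (m - x) (m ^ n) (x ^ n) => u y z <-; nia.
Qed.

(** Dependent random choice with t = 2d, where e^t = (e^2)^d makes the coefficients d-th powers.
    Dropping one or the other term of its left side gives the size of [A] and the scarcity of poor
    tuples. *)
Lemma thin_layer A' B :
  0 < #|A'| -> 0 < #|B| ->
  (forall y, y \in A' -> (q - 2) * #|B| <= 2 * q * #|common_in T B [set y]|) ->
  exists2 A : {set W}, A \subset B &
    #|B| <= 4 * 2 ^ (2 * d) * #|A| /\ safe T A A' e r d set0.
Proof.
move=> A'_gt0 B_gt0 /(dependent_random_choice e d (2 * d) A'_gt0)[A AB].
set t := 2 * d; set bad := poor_extensions _ _ _ _ _ _.
have : (2 * q) ^ t <= 2 * 2 ^ t * (q - 2) ^ t.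
  rewrite expnMn -mulnA mulnCA leq_mul2l; apply/orP; right.
  by apply: leq_expn_double; rewrite /t /q; lia.
have : 0 < (q - 2) ^ t by rewrite expn_gt0 subn_gt0 /q; lia.
have : 0 < (2 * q) ^ t by rewrite expn_gt0 muln_gt0 /q; lia.
rewrite expnM; move: ((q - 2) ^ t) ((2 * q) ^ t) => a b b_gt0 a_gt0 le_ba le_DRC.
have le_aB : a * #|B| <= 2 * (b * #|A|).
  rewrite -(leq_exp2r _ _ d_gt0) expnMn [X in _ <= X]expnMn.
  rewrite expnMn in le_DRC.
  apply: leq_trans (leq_trans (leq_addr _ _) le_DRC) _.
  by rewrite leq_mul2r -[X in X <= _]expn1 leq_pexp2l ?orbT.
have le_B : #|B| <= 4 * 2 ^ t * #|A|.
  rewrite -(leq_pmul2l a_gt0); apply: leq_trans le_aB _.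
  have := leq_mul le_ba (leqnn #|A|); lia.
exists A => //; split=> //.
have A_gt0 : 0 < #|A| by case: posnP le_B => // ->; lia.
have le_rb : 4 * r * b <= a * e ^ 2.
  rewrite expnS expn1 {2}/e /r -/t.
  have := leq_mul (leqnn (8 * D * e)) le_ba; nia.
have Ad_gt0 : 0 < #|A| ^ d by rewrite expn_gt0 A_gt0.
have bd_gt0 : 0 < b ^ d by rewrite expn_gt0 b_gt0.
have le_bad : (4 * r * b) ^ d * bad <= 2 * (b * #|A|) ^ d.
  apply: leq_trans (leq_trans (leq_addl _ _) le_DRC).
  by rewrite leq_mul2r [e ^ t]expnM -expnMn leq_exp2r ?le_rb ?orbT.
rewrite /safe -/bad.
(* The 4 beats the factor 2 of dependent random choice, making the inequality strict. *)
have ge_4 : 4 <= 4 ^ d by rewrite -[X in X <= _]expn1 leq_pexp2l.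
rewrite -(ltn_pmul2l bd_gt0); move: le_bad; rewrite 2!expnMn expnMn.
move: (4 ^ d) (r ^ d) (b ^ d) (#|A| ^ d) ge_4 bd_gt0 Ad_gt0 => f rd bd Ad ge_4 bd_gt0 Ad_gt0 le_bad.
have := leq_mul ge_4 (leqnn (bd * (bad * rd))).
have : 0 < bd * Ad by rewrite muln_gt0 bd_gt0.
lia.
Qed.

Lemma leq_layer_size B A n :
  lam * n <= 2 * q * #|B| -> #|B| <= 4 * 2 ^ (2 * d) * #|A| -> 2 * e * n <= #|A|.
Proof.
rewrite /lam /q /e => le_B le_A.
move: le_B; have -> : 2 ^ (4 * d) = 2 ^ (2 * d) * 2 ^ (2 * d).
  by rewrite -expnD; congr (_ ^ _); lia.
have c_gt0 : 0 < 2 ^ (2 * d) by rewrite expn_gt0.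
have -> : 2 ^ 12 = 32 * (4 * 32) by [].
move: (2 ^ (2 * d)) c_gt0 le_A => c c_gt0 le_A le_B.
rewrite -(@leq_pmul2l (4 * c * (32 * d))) ?muln_gt0 ?c_gt0 ?d_gt0 //.
have := leq_mul (leqnn (32 * d)) le_A; lia.
Qed.

(** The recursion selects the sets [B] forward and thins them backward on return: the later sets are
    finished before [B] is thinned against the first of them. The in-degree condition of
    [next_layer] holds at each vertex of [B'], so it survives the thinning of [B']. *)
Lemma layer_chain k (sz : nat -> nat) X R B :
  uniq (X ++ R) -> median_order T (X ++ R) -> {subset B <= X} ->
  (forall i, i <= k -> 0 < sz i) ->
  size X = lam * sz 0 -> size X <= 2 * q * #|B| ->
  \sum_(i < k) (q * (lam * sz i) + lam * sz i.+1) <= size R ->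
  exists A : nat -> {set W},
    [/\ A 0 \subset B,
        forall i, i <= k -> {subset A i <= X ++ R},
        forall i j, i < j -> j <= k -> [disjoint A i & A j],
        forall i, i <= k -> 2 * e * sz i <= #|A i| &
        forall i, i < k -> safe T (A i) (A i.+1) e r d set0].
Proof.
have lam_gt0 : 0 < lam by rewrite !muln_gt0 !expn_gt0 d_gt0 D_gt0.
elim: k sz X R B => [|k IHk] sz X R B uniqXR med BX sz_gt0 sizeX le_XB le_R.
  exists (fun=> B); split=> // [i _ x xB|i j lt_ij|[|//] _].
  - by rewrite mem_cat BX.
  - by rewrite leqn0 => /eqP j0; rewrite j0 in lt_ij.
  - apply: (@leq_layer_size B); first by rewrite -sizeX.
    by rewrite leq_pmull // muln_gt0 expn_gt0.
have X_gt0 : 0 < size X by rewrite sizeX muln_gt0 lam_gt0 sz_gt0.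
have B_gt0 : 0 < #|B| by case: posnP le_XB => // ->; lia.
have l_gt0 : 0 < lam * sz 1 by rewrite muln_gt0 lam_gt0 sz_gt0.
have q_gt1 : 1 < q by rewrite /q; lia.
move: le_R; rewrite big_ord_recl /= -sizeX => le_R.
have [|R1 [X' [R2 [B' [def_R sizeX' le_R1 B'X' [le_B' minB']]]]]] :=
  next_layer uniqXR med BX l_gt0 X_gt0 B_gt0 q_gt1.
  by apply: leq_trans le_R; apply: leq_addr.
have def_XR : X ++ R = (X ++ R1) ++ (X' ++ R2) by rewrite def_R -catA.
have [uniqXR1 med1] : uniq (X' ++ R2) /\ median_order T (X' ++ R2).
  split; first by move: uniqXR; rewrite def_XR (cat_uniq (X ++ R1)) => /and3P[].
  by apply: (@median_order_cat _ _ (X ++ R1)); rewrite -def_XR.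
have [||||A [A0 Asub Adisj Asz Alink]] :=
  IHk (fun i => sz i.+1) X' R2 B' uniqXR1 med1 B'X'.
- by move=> i le_ik; apply: sz_gt0.
- by [].
- by rewrite sizeX'.
- rewrite -(leq_add2l (q * size X + lam * sz 1)).
  apply: leq_trans le_R _; rewrite def_R !size_cat sizeX' addnA.
  by rewrite !leq_add2r.
have A0_gt0 : 0 < #|A 0|.
  by apply: leq_trans (Asz 0 isT); rewrite !muln_gt0 D_gt0 expn_gt0 sz_gt0.
have [y yA|C CB [le_BC linkC]] := @thin_layer (A 0) B A0_gt0 B_gt0.
  by apply: minB'; apply: (subsetP A0).
have CX : {subset C <= X} by move=> x /(subsetP CB); apply: BX.
exists (fun i => if i is i'.+1 then A i' else C); split=> //.
- case=> [|i] le_ik x; first by move/CX; rewrite mem_cat => ->.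
  by move/(Asub i le_ik) => xA; rewrite def_XR mem_cat xA orbT.
- case=> [|i] [|j] //; last exact: (Adisj i j).
  move=> _ le_jk; apply/pred0P=> x /=; apply/negbTE/negP=> /andP[/CX xX xA].
  have := Asub j le_jk x xA; move: uniqXR; rewrite def_XR cat_uniq.
  by case/and3P=> _ /hasPn/(_ x) /[swap] _ /[swap] xXR /(_ xXR); rewrite /= mem_cat xX.
- case=> [|i] le_ik; last exact: (Asz i).
  by apply: leq_layer_size le_BC; rewrite -sizeX.
- case=> [|i] lt_ik //; exact: (Alink i).
Qed.

End LayerChain.

(** * Greedy embedding, layer by layer *)

Section GreedyEmbedding.

Variables (V : finType) (E : rel V) (W : finType) (T : rel W).
Variables (ht : V -> nat) (k d D e : nat) (A : nat -> {set W}).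

Let r := 2 * D * e.

Hypotheses (ht_edge : forall u v, E u v -> ht v = (ht u).+1)
           (ht_le : forall v, ht v <= k)
           (indeg_le : forall v, #|[set u | E u v]| <= d)
           (outdeg_le : forall v, #|[set u | E v u]| <= D)
           (e_gt0 : 0 < e) (D_gt0 : 0 < D)
           (disjA : forall i j, i < j -> j <= k -> [disjoint A i & A j])
           (sizeA : forall i, i <= k -> 2 * e * #|[set v | ht v == i]| <= #|A i|)
           (safeA : forall i, i < k -> safe T (A i) (A i.+1) e r d set0).

Let inN v : {set V} := [set u | E u v].
Let outN v : {set V} := [set u | E v u].

(** [S] is the set of placed vertices. The invariant [emb_safe] covers every vertex above the bottom
    layer, placed or not: the image of its placed in-neighbours is safe, with a budget of [d] minus
    their number. *)
Record partial_embedding (S : {set V}) (f : V -> W) : Prop := PartialEmbedding {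
  emb_closed : forall u v, E u v -> v \in S -> u \in S;
  emb_layer : forall v, v \in S -> f v \in A (ht v);
  emb_inj : {in S &, injective f};
  emb_edge : forall u v, E u v -> v \in S -> T (f u) (f v);
  emb_safe : forall w i, ht w = i.+1 ->
    safe T (A i) (A i.+1) e r (d - #|inN w :&: S|) (f @: (inN w :&: S))
}.

Lemma layer_eq i j x : i <= k -> j <= k -> x \in A i -> x \in A j -> i = j.
Proof.
move=> le_ik le_jk xi xj; case: (ltngtP i j) => // lt_ij.
  by have /pred0P/(_ x) := disjA lt_ij le_jk; rewrite /= xi xj.
by have /pred0P/(_ x) := disjA lt_ij le_ik; rewrite /= xi xj.
Qed.

(** The candidates [N] fill at least 1/e of [A i]. The used vertices, fewer than the layer has, take
    less than 1/(2e), and those unsafe for some out-neighbour at most D/r = 1/(2e), so a good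
    candidate is left. *)
Lemma extend_partial_embedding S f v :
  partial_embedding S f -> v \notin S -> {subset inN v <= S} ->
  exists f', partial_embedding (v |: S) f'.
Proof.
case=> closed layer inj edge safef vS inS.
set i := ht v.
pose N := common_out T (A i) (f @: inN v).
pose used := f @: [set u in S | ht u == i].
pose bad w := [set x in A i |
  ~~ safe T (A i) (A i.+1) e r (d - #|inN w :&: S|).-1 (x |: f @: (inN w :&: S))].
have r_gt0 : 0 < r by rewrite !muln_gt0 D_gt0.
(* All in-neighbours of [v] are placed, so the invariant applies; in the bottom layer there are none
   and [N] is all of [A i]. *)
have richN : #|A i| <= e * #|N|.
  case def_i: i => [|j].
    rewrite /N; have -> : inN v = set0.
      apply/setP=> u; rewrite !inE; apply/negP=> /ht_edge.
      by rewrite -/i def_i.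
    have -> : common_out T (A i) (f @: set0) = A i.
      apply/setP=> x; rewrite inE; case: (x \in A i) => //=.
      by apply/forall_inP=> y; rewrite imset0 inE.
    by rewrite def_i leq_pmull.
  have := safef v j def_i; rewrite (setIidPl (introT subsetP inS)).
  by move/(safe_rich r_gt0); rewrite /N def_i.
have few_used : #|used| < #|[set u | ht u == i]|.
  apply: leq_ltn_trans (leq_imset_card _ _) _; apply: proper_card.
  apply/properP; split; first by apply/subsetP=> u; rewrite !inE => /andP[].
  by exists v; rewrite !inE ?eqxx // (negPf vS).
have not_all w : w \in outN v -> #|inN w :&: S| < d.
  rewrite inE => Evw; apply: leq_trans (indeg_le w); apply: proper_card.
  apply/properP; split; first exact: subsetIl.
  by exists v; rewrite !inE ?Evw // (negPf vS).
have few_bad w : w \in outN v -> r * #|bad w| <= #|A i|.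
  move=> wv; apply: few_unsafe; rewrite prednK ?subn_gt0 ?not_all //.
  by apply: safef; rewrite (@ht_edge v) //; rewrite inE in wv.
have /subsetPn[x xN x_ok] : ~~ (N \subset used :|: \bigcup_(w in outN v) bad w).
  apply/negP=> /subset_leq_card/leq_trans/(_ (leq_card_setU _ _)) leN.
  have le_bads : 2 * e * #|\bigcup_(w in outN v) bad w| <= #|A i|.
    rewrite -(leq_pmul2l D_gt0) mulnA (mulnA D) [D * 2]mulnC -/r.
    apply: (@leq_trans (r * \sum_(w in outN v) #|bad w|)).
      rewrite leq_mul2l; apply/orP; right.
      elim/big_rec2: _ => [|w n Y _ le_Y]; first by rewrite cards0.
      by apply: leq_trans (leq_card_setU _ _) _; rewrite leq_add2l.
    rewrite big_distrr /=.
    apply: leq_trans (leq_mul (outdeg_le v) (leqnn _)).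
    by rewrite -sum_nat_const; apply: leq_sum.
  have := sizeA (ht_le v); rewrite -/i.
  have : 0 < #|A i|.
    apply: leq_trans (sizeA (ht_le v)); rewrite !muln_gt0 e_gt0 /=.
    exact: leq_ltn_trans few_used.
  move: few_used leN richN le_bads.
  move: #|used| #|N| #|A i| #|\bigcup_(_ in _) _| #|[set _ | _]|; clear -e_gt0; nia.
have [xA xT] : x \in A i /\ forall u, E u v -> T (f u) x.
  move: xN; rewrite inE => /andP[-> /forall_inP xT]; split=> // u Euv.
  by apply: xT; apply: imset_f; rewrite inE.
move: x_ok; rewrite inE negb_or => /andP[x_used x_bad].
pose f' u := if u == v then x else f u.
have f'v : f' v = x by rewrite /f' eqxx.
have f'S u : u \in S -> f' u = f u.
  by move=> uS; rewrite /f'; case: eqP uS vS => // -> ->.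
have f'im (Y : {set V}) : Y \subset S -> f' @: Y = f @: Y.
  by move=> /subsetP YS; apply: eq_in_imset => u /YS /f'S.
have x_fresh u : u \in S -> f u != x.
  move=> uS; apply: contra x_used => /eqP fux.
  apply/imsetP; exists u => //; rewrite inE uS /=; apply/eqP.
  by apply: (layer_eq (ht_le u) (ht_le v) _ xA); rewrite -fux layer.
exists f'; split.
- move=> u w Euw; rewrite !in_setU1 => /predU1P[def_w|wS].
    by rewrite inS ?orbT // inE -def_w.
  by rewrite (closed u w) ?orbT.
- move=> u; rewrite in_setU1 => /predU1P[->|uS]; first by rewrite f'v.
  by rewrite f'S ?layer.
- move=> u w; rewrite !in_setU1 => /predU1P[->|uS] /predU1P[->|wS] //.
  + by rewrite f'v f'S // => def_x; case/eqP: (x_fresh w wS).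
  + by rewrite f'v f'S // => def_x; case/eqP: (x_fresh u uS).
  + by rewrite !f'S //; apply: inj.
- move=> u w Euw; rewrite in_setU1 => /predU1P[def_w|wS].
    have Euv : E u v by rewrite -def_w.
    by rewrite def_w f'v f'S ?xT // inS // inE.
  by rewrite !f'S ?edge // (closed u w).
- move=> w j def_j; case Evw: (E v w).
    have -> : inN w :&: (v |: S) = v |: (inN w :&: S).
      by rewrite setIUr (setIidPr _) // sub1set inE.
    have vw : w \in outN v by rewrite inE.
    have eq_ij : i = j by apply: succn_inj; rewrite -def_j (ht_edge Evw).
    rewrite imsetU1 f'v f'im ?subsetIr // cardsU1 inE (negPf vS) andbF /= add1n.
    move: x_bad; apply: contraNT => bad_x; apply/bigcupP; exists w => //.
    by rewrite inE xA -subnS /= eq_ij.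
  have -> : inN w :&: (v |: S) = inN w :&: S.
    apply/setP=> u; rewrite !inE; case: eqP => [->|] //=.
    by rewrite Evw.
  by rewrite f'im ?subsetIr // safef.
Qed.

Lemma greedy_embedding : 0 < #|V| -> contains_copy E T.
Proof.
move=> V_gt0; case/card_gt0P: (V_gt0) => v0 _.
have /card_gt0P[x0 _] : 0 < #|A (ht v0)|.
  apply: leq_trans (sizeA (ht_le v0)); rewrite !muln_gt0 e_gt0 /=.
  by apply/card_gt0P; exists v0; rewrite inE.
have base : partial_embedding set0 (fun=> x0).
  split=> [u v _|v|u v|u v _|w i def_i]; rewrite ?inE //.
  by rewrite setI0 cards0 subn0 imset0 safeA // -def_i.
suff [f [_ _ inj edge _]] : exists f, partial_embedding setT f.
  exists f; split=> [u v|u v Euv]; first by apply: inj; rewrite inE.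
  by apply: edge; rewrite ?inE.
suff grow n : n <= #|V| -> exists (S : {set V}) f, #|S| = n /\ partial_embedding S f.
  have [S [f [cardS embf]]] := grow _ (leqnn _).
  exists f; suff <- : S = setT by [].
  by apply/eqP; rewrite eqEcard subsetT cardsT cardS leqnn.
elim: n => [|n IHn] lt_nV; first by exists set0, (fun=> x0); rewrite cards0.
have [S [f [cardS embf]]] := IHn (ltnW lt_nV).
have /subsetPn[v1 _ v1S] : ~~ ([set: V] \subset S).
  by apply: contraL lt_nV => /subset_leq_card; rewrite cardsT cardS -leqNgt.
(* An unplaced vertex of least height has all its in-neighbours placed. *)
have [v /= vS min_v] := @arg_minnP _ v1 [predC S] ht v1S.
have [|f' embf'] := extend_partial_embedding embf vS.
  move=> u; rewrite inE => /ht_edge htv; apply/negPn/negP=> /min_v.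
  by rewrite htv ltnn.
by exists (v |: S), f'; rewrite cardsU1 vS cardS.
Qed.

End GreedyEmbedding.

(** * Height functions and degrees of graded digraphs *)

Section Grading.

Variables (V : finType) (E : rel V).

Lemma graded_height :
  graded E -> exists ht : V -> nat, forall u v, E u v -> ht v = (ht u).+1.
Proof.
case=> h [P [disjP _ edgeP]].
pose ht v := if [pick i | v \in P i] is Some i then val i else 0.
have htE v i : v \in P i -> ht v = i.
  rewrite /ht => vi; case: pickP => [j vj|/(_ i)]; last by rewrite vi.
  case: (eqVneq j i) => [-> //|/disjP/pred0P/(_ v)].
  by rewrite /= vj vi.
exists ht => u v /edgeP[i [j [def_j ui vj]]].
by rewrite (htE _ _ ui) (htE _ _ vj).
Qed.

(* The height is replaced by the number of nonempty layers below it. *)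
Lemma graded_height_onto :
  graded E -> exists ht : V -> nat,
    (forall u v, E u v -> ht v = (ht u).+1) /\
    (forall v i, i <= ht v -> exists u, ht u = i).
Proof.
case/graded_height=> ht0 ht0_edge.
pose rank n := \sum_(j < n) [exists u, ht0 u == j].
have rankS n : rank n.+1 = rank n + [exists u, ht0 u == n].
  by rewrite /rank big_ord_recr.
have rank_ht0 u : rank (ht0 u).+1 = (rank (ht0 u)).+1.
  rewrite rankS; have -> : [exists w, ht0 w == ht0 u]; last by rewrite addn1.
  by apply/existsP; exists u.
exists (rank \o ht0); split=> [u v /ht0_edge /= ->|v i] //=.
(* [rank] grows by steps of at most 1, and only at attained heights, so no value is skipped. *)
rewrite -ltnS -rank_ht0; elim: (ht0 v).+1 => [|n IHn]; first by rewrite /rank big_ord0.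
rewrite rankS; case: existsP => [[u /eqP def_n]|_]; last by rewrite addn0.
rewrite addn1 ltnS leq_eqVlt => /orP[/eqP->|/IHn //].
by exists u; rewrite def_n.
Qed.

Lemma max_indegree_gt0 u v : E u v -> 0 < max_indegree E.
Proof.
move=> Euv; apply: leq_trans (leq_bigmax v).
by apply/card_gt0P; exists u; rewrite inE.
Qed.

Lemma max_outdegree_gt0 u v : E u v -> 0 < max_outdegree E.
Proof.
move=> Euv; apply: leq_trans (leq_bigmax u).
by apply/card_gt0P; exists v; rewrite inE.
Qed.

Lemma max_indegree_le : max_indegree E <= max_degree E.
Proof.
apply/bigmax_leqP=> v _; apply: leq_trans (leq_bigmax v).
by apply: subset_leq_card; apply/subsetP=> u; rewrite !inE => ->.
Qed.

Lemma max_outdegree_le : max_outdegree E <= max_degree E.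
Proof.
apply/bigmax_leqP=> v _; apply: leq_trans (leq_bigmax v).
by apply: subset_leq_card; apply/subsetP=> u; rewrite !inE orbC => ->.
Qed.

Lemma max_degree_edge : 0 < max_degree E -> exists u v, E u v.
Proof.
case: (pickP (fun v => 0 < #|[set u | E u v || E v u]|)) => [v|noE].
  case/card_gt0P=> u; rewrite inE => /orP[] Euv _; first by exists u, v.
  by exists v, u.
rewrite ltnNge; case/negP; apply/bigmax_leqP=> v _.
by rewrite leqNgt noE.
Qed.

End Grading.

(** * The bound on the oriented Ramsey number *)

(** Layer i takes [lam * sz i] vertices of the median order, and at most q times as many are skipped
    after it: at most (q + 1) lam #|V| in all. *)
Lemma graded_copy (V : finType) (E : rel V) (W : finType) (T : rel W) (d D : nat) :
  graded E -> tournament T -> 0 < #|V| -> 0 < d -> 0 < D ->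
  (forall v, #|[set u | E u v]| <= d) -> (forall v, #|[set u | E v u]| <= D) ->
  (16 * d).+1 * (2 ^ 12 * D * d * 2 ^ (4 * d)) * #|V| <= #|W| ->
  contains_copy E T.
Proof.
move=> /graded_height_onto[ht [ht_edge ht_onto]] tourT V_gt0 d_gt0 D_gt0 indeg outdeg.
set q := 16 * d; set lam := 2 ^ 12 * _ * _ * _ => le_W.
have [s perm_s med_s] := exists_median_order tourT.
have size_s : size s = #|W| by rewrite (perm_size perm_s) cardE.
have uniq_s : uniq s by rewrite (perm_uniq perm_s) enum_uniq.
pose k := \max_v ht v; pose sz i := #|[set v | ht v == i]|.
have ht_le v : ht v <= k by apply: leq_bigmax.
have sz_gt0 i : i <= k -> 0 < sz i.
  have [v _] : {v | v \in V & k = ht v} by apply: eq_bigmax_cond.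
  move=> -> /ht_onto[u htu]; apply/card_gt0P; exists u.
  by rewrite inE htu.
have sum_sz : \sum_(i < k.+1) sz i = #|V|.
  rewrite -sum1_card (partition_big (fun v => inord (ht v) : 'I_k.+1) xpredT) //=.
  apply: eq_bigr => i _; rewrite /sz -sum1_card; apply: eq_bigl => v.
  rewrite inE -(inj_eq val_inj) /= inordK //; exact: ht_le.
have sum_le : lam * sz 0 + \sum_(i < k) (q * (lam * sz i) + lam * sz i.+1)
    <= size s.
  rewrite size_s; apply: leq_trans le_W.
  have le_V : \sum_(i < k) sz i <= #|V| by rewrite -sum_sz big_ord_recr leq_addr.
  have def_V : sz 0 + \sum_(i < k) sz i.+1 = #|V| by rewrite -sum_sz big_ord_recl.
  rewrite big_split -!big_distrr /= addnCA -mulnDr def_V -mulnA mulSnr.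
  by rewrite leq_add2r !leq_mul.
have sizeX : size (take (lam * sz 0) s) = lam * sz 0.
  by rewrite size_takel // (leq_trans (leq_addr _ _) sum_le).
have [|||||||A [_ _ disjA sizeA safeA]] := @layer_chain W T d D d_gt0 D_gt0 k sz
  (take (lam * sz 0) s) (drop (lam * sz 0) s) [set x in take (lam * sz 0) s].
- by rewrite cat_take_drop.
- by rewrite cat_take_drop.
- by move=> x; rewrite inE.
- exact: sz_gt0.
- exact: sizeX.
- have -> : #|[set x in take (lam * sz 0) s]| = size (take (lam * sz 0) s).
    by rewrite cardsE; apply/card_uniqP; apply: take_uniq.
  by rewrite leq_pmull // !muln_gt0 d_gt0.
- by rewrite size_drop leq_subRL // (leq_trans (leq_addr _ _) sum_le).
apply: (@greedy_embedding _ E W T ht k d D (16 * D * 2 ^ (2 * d)) A) => //.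
by rewrite !muln_gt0 D_gt0 expn_gt0.
Qed.

(** Well-ordering by strong induction; excluded middle decides whether a smaller unavoidable number
    exists. *)
Lemma oriented_ramsey_exists (V : finType) (E : rel V) N :
  unavoidable E N -> exists2 r, is_oriented_ramsey E r & r <= N.
Proof.
elim/ltn_ind: N => N IHN unavN.
case: (classic (exists2 M, M < N & unavoidable E M)) => [[M ltMN unavM]|minN].
  have [r Er le_rM] := IHN M ltMN unavM.
  by exists r => //; apply: leq_trans le_rM (ltnW ltMN).
exists N => //; split=> // M unavM; rewrite leqNgt; apply/negP=> ltMN.
by apply: minN; exists M.
Qed.

Theorem theorem1p3 (V : finType) (E : rel V) :
  graded E -> 0 < max_degree E ->
  exists r : nat,
    [/\ is_oriented_ramsey E r,
        r <= 10 ^ 9 * max_degree E ^ 3 * 2 ^ (4 * max_degree E) * #|V| &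
        r <= 10 ^ 9 * max_outdegree E * max_indegree E ^ 2
             * 2 ^ (4 * max_indegree E) * #|V|].
Proof.
move=> gradedE /max_degree_edge[u [v Euv]].
have d_gt0 := max_indegree_gt0 Euv; have D_gt0 := max_outdegree_gt0 Euv.
have V_gt0 : 0 < #|V| by apply/card_gt0P; exists u.
have indeg w : #|[set x | E x w]| <= max_indegree E.
  exact: (leq_bigmax (F := fun w => #|[set x | E x w]|)).
have outdeg w : #|[set x | E w x]| <= max_outdegree E.
  exact: (leq_bigmax (F := fun w => #|[set x | E w x]|)).
have := max_indegree_le E; have := max_outdegree_le E.
move: (max_indegree E) (max_outdegree E) (max_degree E) d_gt0 D_gt0 indeg outdeg.
move=> d D m d_gt0 D_gt0 indeg outdeg le_Dm le_dm.
have [r Er le_r] : exists2 r, is_oriented_ramsey E r &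
    r <= (16 * d).+1 * (2 ^ 12 * D * d * 2 ^ (4 * d)) * #|V|.
  apply: oriented_ramsey_exists => T tourT.
  by apply: (graded_copy gradedE tourT V_gt0 d_gt0 D_gt0 indeg outdeg); rewrite card_ord.
have le2 : r <= 10 ^ 9 * D * d ^ 2 * 2 ^ (4 * d) * #|V|.
  apply: leq_trans le_r _; rewrite leq_mul2r; apply/orP; right.
  (* 16 d + 1 <= 2^5 d brings the constant to 2^17, and 2^17 <= 2^27 = 8^9 <= 10^9. *)
  have le_c : 2 ^ 5 * 2 ^ 12 <= 10 ^ 9.
    rewrite -expnD; apply: (@leq_trans (2 ^ (3 * 9))); first by rewrite leq_exp2l.
    by rewrite expnM leq_exp2r.
  have le_d : (16 * d).+1 <= 2 ^ 5 * d by rewrite !expnS expn0; lia.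
  move: (2 ^ (4 * d)) (2 ^ 5) (2 ^ 12) (10 ^ 9) le_c le_d => p a b c le_c le_d.
  have := leq_mul (leq_mul le_d (leqnn (b * D * d * p))) (leqnn 1).
  have := leq_mul le_c (leqnn (D * d * d * p)).
  rewrite expnS expn1; nia.
exists r; split=> //; apply: leq_trans le2 _.
rewrite leq_mul2r; apply/orP; right; apply: leq_mul; last first.
  by rewrite leq_exp2l // leq_mul2l le_dm orbT.
by rewrite -mulnA leq_mul2l; apply/orP; right; rewrite (expnS m) leq_mul // leq_exp2r.
Qed.
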